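(* There are constants $c,C>0$ such that for all sufficiently large $n$ and all $p,q\in(0,1)$ with $\hat p=\frac{p}{p+q}\ge c\frac{\log n}{n}$, with probability at least $1-1/n$ the flooding time of the stationary edge-MEG $\mathcal{M}(n,p,q)$ is at most $$C\left(\frac{\log n}{\log(n\hat p)}+\log\log(n\hat p)\right).$$
   Context: The edge-MEG $\mathcal{M}(n,p,q)=\{G_t\}$ on node set $[n]$: for each pair $e\in\binom{[n]}{2}$ there is an independent two-state Markov chain $X_t(e)\in\{0,1\}$ with $\Pr[X_{t+1}(e)=1\mid X_t(e)=0]=p$ and $\Pr[X_{t+1}(e)=0\mid X_t(e)=1]=q$; $G_t=([n],\{e:X_t(e)=1\})$. It is stationary when $G_0$ is drawn from the stationary distribution, which is the Erdős–Rényi graph $G_{n,\hat p}$, $\hat p=p/(p+q)$. Flooding from source $s$: $I_0=\{s\}$, $I_{t+1}=I_t\cup N_t(I_t)$ where $N_t(I)$ is the set of nodes outside $I$ adjacent in $G_t$ to some node of $I$; $T(s)$ is the first $t$ with $I_t=[n]$; the flooding time is $\max_s T(s)$. Logarithms are natural. *)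

(* Defs.v *)
From Stdlib Require Import Reals List Arith Bool.
Import ListNotations.
Open Scope R_scope.

(* Node set [n] = {0,...,n-1}; the pairs e in binom([n],2) as (i,j), i<j<n. *)
Definition edges (n : nat) : list (nat * nat) :=
  flat_map (fun j => map (fun i => (i, j)) (seq 0 j)) (seq 0 n).

(* A graph G_t on [n] is a list of edge states X_t(e), aligned with [edges n]. *)
Definition graph := list bool.

Fixpoint all_bools (m : nat) : list (list bool) :=
  match m with
  | O => [nil]
  | S m' => flat_map (fun l => [true :: l; false :: l]) (all_bools m')
  end.

Definition all_graphs (n : nat) : list graph := all_bools (length (edges n)).

(* All sequences of length k over xs (first element = earliest time). *)
Fixpoint seqs {A : Type} (xs : list A) (k : nat) : list (list A) :=
  match k with
  | O => [nil]
  | S k' => flat_map (fun l => map (fun x => x :: l) xs) (seqs xs k')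
  end.

Definition adj (n : nat) (g : graph) (u v : nat) : bool :=
  existsb (fun eb : (nat * nat) * bool =>
             let '(e, b) := eb in
             b && (((fst e =? u) && (snd e =? v)) || ((fst e =? v) && (snd e =? u))))%nat
          (combine (edges n) g).

Definition flood_step (n : nat) (g : graph) (I : nat -> bool) : nat -> bool :=
  fun v => I v || existsb (fun u => I u && adj n g u v) (seq 0 n).

(* I_T, given the trajectory [G_0; ...; G_{T-1}] and initial set I_0 *)
Fixpoint informed (n : nat) (tr : list graph) (I : nat -> bool) : nat -> bool :=
  match tr with
  | nil => I
  | g :: rest => informed n rest (flood_step n g I)
  end.

(* flooding time <= T  iff  for every source s, I_T = [n] (I_0 = {s}) *)
Definition flooded_by (n : nat) (tr : list graph) : bool :=
  forallb (fun s => forallb (informed n tr (fun v => (s =? v)%nat)) (seq 0 n)) (seq 0 n).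

Definition edge_step_prob (p q : R) (b b' : bool) : R :=
  match b, b' with
  | false, true => p
  | false, false => 1 - p
  | true, false => q
  | true, true => 1 - q
  end.

Definition trans_prob (p q : R) (g g' : graph) : R :=
  fold_right Rmult 1 (map (fun bb : bool * bool => edge_step_prob p q (fst bb) (snd bb))
                          (combine g g')).

Definition stat_prob (ph : R) (g : graph) : R :=
  fold_right Rmult 1 (map (fun b : bool => if b then ph else 1 - ph) g).

Fixpoint chain_prob (p q : R) (g : graph) (rest : list graph) : R :=
  match rest with
  | nil => 1
  | g' :: rest' => trans_prob p q g g' * chain_prob p q g' rest'
  end.

Definition traj_prob (p q : R) (tr : list graph) : R :=
  match tr with
  | nil => 1
  | g :: rest => stat_prob (p / (p + q)) g * chain_prob p q g rest
  end.

Definition prob_flooded_by (n : nat) (p q : R) (T : nat) : R :=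
  fold_right Rplus 0
    (map (fun tr => if flooded_by n tr then traj_prob p q tr else 0)
         (seqs (all_graphs n) T)).

(* Main.v *)
Require Import Defs.
From Stdlib Require Import Reals.
From Stdlib Require Import List Arith ZArith Bool Lia Lra Permutation.
Import ListNotations.
Open Scope R_scope.

(* Write ph = p/(p+q) and d = n ph. Every graph of the stationary chain is
   distributed as G(n, ph), so a union bound over time reduces the theorem to
   properties of a single random graph, whatever the dependence between steps.
   With probability at least 1 - 3/n^3, every node set A with |A| <= 1/ph
   reaches at least |A| d/8 nodes in one step, and any two disjoint
   sets of size at least about n/16 are joined by an edge; both follow from a
   first moment bound over pairs of sets with no edge between them. Hence the set
   reached from a source s forwards in time, and the set from which a target v
   is reached, backwards in time, both grow to about n/16 nodes in
   O(log n / log d) steps, and one more step joins them. *)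

(** * Finite sums *)

Definition Rsum {A : Type} (f : A -> R) (l : list A) : R :=
  fold_right Rplus 0 (map f l).

Lemma Rsum_cons {A : Type} (f : A -> R) (x : A) (l : list A) :
  Rsum f (x :: l) = f x + Rsum f l.
Proof. reflexivity. Qed.

Lemma Rsum_app {A : Type} (f : A -> R) (l l' : list A) :
  Rsum f (l ++ l') = Rsum f l + Rsum f l'.
Proof.
  induction l as [|x l IH]; simpl.
  - unfold Rsum at 2; simpl; ring.
  - rewrite !Rsum_cons, IH; ring.
Qed.

Lemma Rsum_map {A B : Type} (h : A -> B) (f : B -> R) (l : list A) :
  Rsum f (map h l) = Rsum (fun x => f (h x)) l.
Proof. unfold Rsum; now rewrite map_map. Qed.

Lemma Rsum_flat_map {A B : Type} (h : A -> list B) (f : B -> R) (l : list A) :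
  Rsum f (flat_map h l) = Rsum (fun x => Rsum f (h x)) l.
Proof.
  induction l as [|x l IH]; simpl; [reflexivity|].
  now rewrite Rsum_app, Rsum_cons, IH.
Qed.

Lemma Rsum_ext {A : Type} (f g : A -> R) (l : list A) :
  (forall x, In x l -> f x = g x) -> Rsum f l = Rsum g l.
Proof.
  intros H; unfold Rsum; f_equal; now apply map_ext_in.
Qed.

Lemma Rsum_le {A : Type} (f g : A -> R) (l : list A) :
  (forall x, In x l -> f x <= g x) -> Rsum f l <= Rsum g l.
Proof.
  induction l as [|x l IH]; intros H; [apply Rle_refl|].
  rewrite !Rsum_cons; apply Rplus_le_compat.
  - apply H; now left.
  - apply IH; intros y Hy; apply H; now right.
Qed.

Lemma Rsum_plus {A : Type} (f g : A -> R) (l : list A) :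
  Rsum (fun x => f x + g x) l = Rsum f l + Rsum g l.
Proof.
  induction l as [|x l IH]; [unfold Rsum; simpl; ring|].
  rewrite !Rsum_cons, IH; ring.
Qed.

Lemma Rsum_scal {A : Type} (a : R) (f : A -> R) (l : list A) :
  Rsum (fun x => a * f x) l = a * Rsum f l.
Proof.
  induction l as [|x l IH]; [unfold Rsum; simpl; ring|].
  rewrite !Rsum_cons, IH; ring.
Qed.

Lemma Rsum_zero {A : Type} (l : list A) : Rsum (fun _ => 0) l = 0.
Proof.
  induction l as [|x l IH]; [reflexivity|]; rewrite Rsum_cons, IH; ring.
Qed.

Lemma Rsum_nonneg {A : Type} (f : A -> R) (l : list A) :
  (forall x, In x l -> 0 <= f x) -> 0 <= Rsum f l.
Proof.
  intros H; rewrite <- (Rsum_zero l); now apply Rsum_le.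
Qed.

Lemma Rsum_swap {A B : Type} (f : A -> B -> R) (l : list A) (l' : list B) :
  Rsum (fun x => Rsum (f x) l') l = Rsum (fun y => Rsum (fun x => f x y) l) l'.
Proof.
  induction l as [|x l IH].
  - symmetry; apply Rsum_zero.
  - rewrite Rsum_cons, IH, <- Rsum_plus; reflexivity.
Qed.

Lemma Rsum_ge_term {A : Type} (f : A -> R) (l : list A) (a : A) :
  In a l -> (forall x, In x l -> 0 <= f x) -> f a <= Rsum f l.
Proof.
  induction l as [|x l IH]; intros Ha H; [contradiction|].
  rewrite Rsum_cons.
  assert (Hx : 0 <= f x) by (apply H; now left).
  assert (Hl : forall y, In y l -> 0 <= f y) by (intros y Hy; apply H; now right).
  destruct Ha as [<-|Ha].
  - pose proof (Rsum_nonneg f l Hl); lra.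
  - pose proof (IH Ha Hl); lra.
Qed.

Definition ind (b : bool) : R := if b then 1 else 0.

Lemma ind_bounds (b : bool) : 0 <= ind b <= 1.
Proof. destruct b; simpl; lra. Qed.

(** * Stationarity and the union bound over time *)

(** Expectation over the Erdős-Rényi graph with edge probability [ph], where [m] is the number of
    node pairs rather than of nodes. *)
Definition Egraph (ph : R) (m : nat) (f : graph -> R) : R :=
  Rsum (fun g => stat_prob ph g * f g) (all_bools m).

Lemma Rsum_all_bools_S (m : nat) (f : graph -> R) :
  Rsum f (all_bools (S m)) =
  Rsum (fun g : graph => f (true :: g)) (all_bools m)
  + Rsum (fun g : graph => f (false :: g)) (all_bools m).
Proof.
  simpl; rewrite Rsum_flat_map, <- Rsum_plus.
  apply Rsum_ext; intros g _; unfold Rsum; simpl; ring.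
Qed.

Lemma length_all_bools (m : nat) (g : list bool) :
  In g (all_bools m) -> length g = m.
Proof.
  revert g; induction m as [|m IH]; simpl; intros g H.
  - now destruct H as [<-|[]].
  - apply in_flat_map in H; destruct H as [l [Hl [<-|[<-|[]]]]];
      simpl; now rewrite (IH l Hl).
Qed.

Lemma Egraph_S (ph : R) (m : nat) (f : graph -> R) :
  Egraph ph (S m) f =
  ph * Egraph ph m (fun g => f (true :: g))
  + (1 - ph) * Egraph ph m (fun g => f (false :: g)).
Proof.
  unfold Egraph; rewrite Rsum_all_bools_S, <- !Rsum_scal.
  f_equal; apply Rsum_ext; intros g _; unfold stat_prob; simpl; ring.
Qed.

Lemma Egraph_const (ph : R) (m : nat) (a : R) : Egraph ph m (fun _ => a) = a.
Proof.
  induction m as [|m IH].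
  - unfold Egraph, Rsum, stat_prob; simpl; ring.
  - rewrite Egraph_S, IH; ring.
Qed.

Lemma stat_prob_nonneg (ph : R) (g : graph) :
  0 <= ph <= 1 -> 0 <= stat_prob ph g.
Proof.
  intros H; induction g as [|b g IH]; unfold stat_prob in *; simpl; [lra|].
  apply Rmult_le_pos; [destruct b; lra|exact IH].
Qed.

Lemma Egraph_ext (ph : R) (m : nat) (f f' : graph -> R) :
  (forall g, f g = f' g) -> Egraph ph m f = Egraph ph m f'.
Proof. intros H; apply Rsum_ext; intros g _; now rewrite H. Qed.

Lemma Egraph_le (ph : R) (m : nat) (f f' : graph -> R) :
  0 <= ph <= 1 -> (forall g, f g <= f' g) -> Egraph ph m f <= Egraph ph m f'.
Proof.
  intros Hp H; apply Rsum_le; intros g _.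
  apply Rmult_le_compat_l; [now apply stat_prob_nonneg|apply H].
Qed.

Lemma Egraph_plus (ph : R) (m : nat) (f f' : graph -> R) :
  Egraph ph m (fun g => f g + f' g) = Egraph ph m f + Egraph ph m f'.
Proof.
  unfold Egraph; rewrite <- Rsum_plus; apply Rsum_ext; intros; ring.
Qed.

Lemma Egraph_scal (ph : R) (m : nat) (a : R) (f : graph -> R) :
  Egraph ph m (fun g => a * f g) = a * Egraph ph m f.
Proof.
  unfold Egraph; rewrite <- Rsum_scal; apply Rsum_ext; intros; ring.
Qed.

Lemma Egraph_Rsum {A : Type} (ph : R) (m : nat) (f : A -> graph -> R) (l : list A) :
  Egraph ph m (fun g => Rsum (fun a => f a g) l)
  = Rsum (fun a => Egraph ph m (f a)) l.
Proof.
  unfold Egraph; rewrite Rsum_swap; apply Rsum_ext; intros g _.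
  now rewrite Rsum_scal.
Qed.

Lemma trans_prob_nonneg (p q : R) (g g' : graph) :
  0 <= p <= 1 -> 0 <= q <= 1 -> 0 <= trans_prob p q g g'.
Proof.
  intros Hp Hq; revert g'; induction g as [|b g IH]; intros [|b' g'];
    unfold trans_prob in *; simpl; try lra.
  apply Rmult_le_pos; [destruct b, b'; simpl; lra|apply IH].
Qed.

Lemma traj_prob_nonneg (p q : R) (tr : list graph) :
  0 < p < 1 -> 0 < q < 1 -> 0 <= p / (p + q) <= 1 -> 0 <= traj_prob p q tr.
Proof.
  intros Hp Hq Hph; destruct tr as [|g tr]; simpl; [lra|].
  apply Rmult_le_pos; [now apply stat_prob_nonneg|].
  revert g; induction tr as [|g' tr IH]; intros g; simpl; [lra|].
  apply Rmult_le_pos; [apply trans_prob_nonneg; lra|apply IH].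
Qed.

Lemma trans_prob_cons (p q : R) (b b' : bool) (g g' : graph) :
  trans_prob p q (b :: g) (b' :: g') = edge_step_prob p q b b' * trans_prob p q g g'.
Proof. reflexivity. Qed.

Lemma trans_prob_total (p q : R) (g : graph) :
  Rsum (trans_prob p q g) (all_bools (length g)) = 1.
Proof.
  induction g as [|b g IH]; [unfold Rsum, trans_prob; simpl; ring|].
  simpl length; rewrite Rsum_all_bools_S.
  rewrite (Rsum_ext _ (fun g' => edge_step_prob p q b true * trans_prob p q g g'))
    by (intros; apply trans_prob_cons).
  rewrite (Rsum_ext (fun g' => trans_prob p q (b :: g) (false :: g'))
             (fun g' => edge_step_prob p q b false * trans_prob p q g g'))
    by (intros; apply trans_prob_cons).
  rewrite !(Rsum_scal _ (trans_prob p q g)), IH; destruct b; simpl; ring.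
Qed.

(** Both weights are products over the edges, so induction splits off one edge at a time. What
    remains is stationarity of the two-state chain, [ph * (1 - q) + (1 - ph) * p = ph], and its
    complement. *)
Lemma stat_prob_invariant (p q : R) (g' : graph) :
  p + q <> 0 ->
  Rsum (fun g => stat_prob (p / (p + q)) g * trans_prob p q g g')
    (all_bools (length g')) = stat_prob (p / (p + q)) g'.
Proof.
  intros Hpq; set (ph := p / (p + q)).
  induction g' as [|b g' IH]; [unfold Rsum, stat_prob, trans_prob; simpl; ring|].
  simpl length; rewrite Rsum_all_bools_S.
  rewrite (Rsum_ext (fun g => stat_prob ph (true :: g) * _)
    (fun g => (ph * edge_step_prob p q true b) * (stat_prob ph g * trans_prob p q g g')))
    by (intros; rewrite trans_prob_cons; unfold stat_prob; simpl; ring).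
  rewrite (Rsum_ext (fun g => stat_prob ph (false :: g) * _)
    (fun g => ((1 - ph) * edge_step_prob p q false b)
              * (stat_prob ph g * trans_prob p q g g')))
    by (intros; rewrite trans_prob_cons; unfold stat_prob; simpl; ring).
  rewrite !Rsum_scal; unfold graph in *; rewrite IH.
  unfold stat_prob at 3; simpl; fold (stat_prob ph g').
  destruct b; simpl; unfold ph; field; exact Hpq.
Qed.

Lemma Rsum_seqs_S {A : Type} (xs : list A) (k : nat) (f : list A -> R) :
  Rsum f (seqs xs (S k)) = Rsum (fun l => Rsum (fun x => f (x :: l)) xs) (seqs xs k).
Proof.
  simpl; rewrite Rsum_flat_map; apply Rsum_ext; intros l _; apply Rsum_map.
Qed.

Lemma seqs_spec {A : Type} (xs : list A) (k : nat) (l : list A) :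
  In l (seqs xs k) -> length l = k /\ forall x, In x l -> In x xs.
Proof.
  revert l; induction k as [|k IH]; simpl; intros l H.
  - destruct H as [<-|[]]; split; [reflexivity|intros x []].
  - apply in_flat_map in H; destruct H as [l' [Hl' H]].
    apply in_map_iff in H; destruct H as [x [<- Hx]].
    destruct (IH l' Hl') as [Hlen Hin]; split; simpl; [now rewrite Hlen|].
    intros y [<-|Hy]; auto.
Qed.

Lemma chain_prob_total (p q : R) (m k : nat) (g : graph) :
  length g = m -> Rsum (chain_prob p q g) (seqs (all_bools m) k) = 1.
Proof.
  revert g; induction k as [|k IH]; intros g Hg; [unfold Rsum; simpl; ring|].
  rewrite Rsum_seqs_S, Rsum_swap; simpl.
  rewrite (Rsum_ext _ (trans_prob p q g)).
  - rewrite <- Hg; apply trans_prob_total.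
  - intros g' Hg'; rewrite Rsum_scal, IH; [ring|now apply length_all_bools].
Qed.

(** Linearity of expectation over time, with no independence between steps. Induction removes the
    earliest graph: its own contribution is [Egraph], because the later transitions sum to 1, and
    summing it out leaves a shorter stationary trajectory by [stat_prob_invariant]. *)
Lemma traj_expectation (p q : R) (m T : nat) (f : graph -> R) :
  p + q <> 0 ->
  Rsum (fun tr => traj_prob p q tr * Rsum f tr) (seqs (all_bools m) T)
  = INR T * Egraph (p / (p + q)) m f.
Proof.
  intros Hpq; set (ph := p / (p + q)).
  induction T as [|T IH]; [unfold Rsum; simpl; ring|].
  rewrite Rsum_seqs_S.
  rewrite (Rsum_ext _ (fun tr =>
     Rsum (fun g => stat_prob ph g * f g * chain_prob p q g tr) (all_bools m)
     + traj_prob p q tr * Rsum f tr)).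
  - rewrite Rsum_plus; unfold graph in *; rewrite IH, S_INR, Rsum_swap.
    replace (Rsum _ (all_bools m)) with (Egraph ph m f); [ring|].
    apply Rsum_ext; intros g Hg.
    rewrite Rsum_scal, chain_prob_total; [ring|now apply length_all_bools].
  - intros tr Htr.
    rewrite (Rsum_ext _ (fun g => stat_prob ph g * f g * chain_prob p q g tr
                        + Rsum f tr * (stat_prob ph g * chain_prob p q g tr)))
      by (intros; rewrite Rsum_cons; simpl; fold ph; ring).
    rewrite Rsum_plus, Rsum_scal; f_equal; rewrite Rmult_comm; f_equal.
    destruct tr as [|g' tr]; simpl.
    + exact (Egraph_const ph m 1).
    + rewrite (Rsum_ext _ (fun g => chain_prob p q g' tr
                 * (stat_prob ph g * trans_prob p q g g'))) by (intros; ring).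
      apply seqs_spec in Htr; destruct Htr as [_ Htr].
      specialize (Htr g' (or_introl eq_refl)); apply length_all_bools in Htr.
      rewrite Rsum_scal, <- Htr; unfold ph.
      rewrite stat_prob_invariant by exact Hpq; ring.
Qed.

Lemma traj_prob_total (p q : R) (m T : nat) :
  p + q <> 0 -> Rsum (traj_prob p q) (seqs (all_bools m) T) = 1.
Proof.
  intros Hpq; destruct T as [|T]; [unfold Rsum; simpl; ring|].
  rewrite Rsum_seqs_S, Rsum_swap; simpl.
  rewrite <- (Egraph_const (p / (p + q)) m 1); apply Rsum_ext; intros g Hg.
  rewrite Rsum_scal, chain_prob_total; [ring|now apply length_all_bools].
Qed.

(** Markov's inequality in union bound form: a trajectory that fails to flood contains a graph with
    [f g >= 1], so the failure indicator is at most [Rsum f tr], whose mean is given by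
    [traj_expectation]. *)
Lemma prob_flooded_by_ge (n T : nat) (p q : R) (f : graph -> R) :
  0 < p < 1 -> 0 < q < 1 -> (forall g, 0 <= f g) ->
  (forall tr, length tr = T -> (forall g, In g tr -> f g < 1) ->
     flooded_by n tr = true) ->
  1 - INR T * Egraph (p / (p + q)) (length (edges n)) f <= prob_flooded_by n p q T.
Proof.
  intros Hp Hq Hf Hflood.
  assert (Hpq : p + q <> 0) by lra.
  assert (Hph : 0 <= p / (p + q) <= 1).
  { split.
    - apply Rlt_le, Rdiv_lt_0_compat; lra.
    - apply Rmult_le_reg_r with (p + q); [lra|]; field_simplify; lra. }
  rewrite <- traj_expectation by exact Hpq.
  rewrite <- (traj_prob_total p q (length (edges n)) T Hpq).
  change (prob_flooded_by n p q T) with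
    (Rsum (fun tr => if flooded_by n tr then traj_prob p q tr else 0)
       (seqs (all_bools (length (edges n))) T)).
  set (l := seqs _ T).
  apply Rplus_le_reg_r with (Rsum (fun tr => traj_prob p q tr * Rsum f tr) l).
  unfold Rminus; rewrite Rplus_assoc, Rplus_opp_l, Rplus_0_r, <- Rsum_plus.
  apply Rsum_le; intros tr Htr.
  pose proof (traj_prob_nonneg p q tr Hp Hq Hph) as Hpos.
  assert (Hs : 0 <= Rsum f tr) by (apply Rsum_nonneg; auto).
  destruct (flooded_by n tr) eqn:E; [nra|].
  assert (1 <= Rsum f tr); [|nra].
  apply Rnot_lt_le; intros Hlt.
  rewrite Hflood in E; [discriminate|now apply seqs_spec in Htr|].
  intros g Hg; apply Rle_lt_trans with (2 := Hlt).
  now apply Rsum_ge_term.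
Qed.

(** * Pairs of node sets without edges between them *)

Fixpoint sublists {A : Type} (l : list A) : list (list A) :=
  match l with
  | nil => [nil]
  | x :: l' => map (cons x) (sublists l') ++ sublists l'
  end.

(** Binomial theorem: each element is either taken, with weight [x], or left out, with weight 1. The
    case [x = 1] counts the sublists. *)
Lemma Rsum_sublists_pow {A : Type} (x : R) (l : list A) :
  Rsum (fun B => x ^ length B) (sublists l) = (1 + x) ^ length l.
Proof.
  induction l as [|a l IH]; [unfold Rsum; simpl; ring|].
  simpl; rewrite Rsum_app, Rsum_map, IH; simpl.
  rewrite (Rsum_scal x (fun B : list A => x ^ length B)), IH; ring.
Qed.

(** The sublists counted are exactly those of [filter Q l]. *)
Lemma Rsum_sublists_forallb {A : Type} (Q : A -> bool) (l : list A) :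
  Rsum (fun B => ind (forallb Q B)) (sublists l) = 2 ^ length (filter Q l).
Proof.
  induction l as [|a l IH]; [unfold Rsum; simpl; ring|].
  simpl; rewrite Rsum_app, Rsum_map, IH; simpl.
  destruct (Q a); simpl.
  - rewrite IH; ring.
  - rewrite Rsum_zero; ring.
Qed.

Lemma filter_sublists {A : Type} (Q : A -> bool) (l : list A) :
  In (filter Q l) (sublists l).
Proof.
  induction l as [|a l IH]; simpl; [now left|].
  apply in_or_app; destruct (Q a); [left; now apply in_map|now right].
Qed.

Lemma sublists_incl {A : Type} (l B : list A) :
  In B (sublists l) -> incl B l.
Proof.
  revert B; induction l as [|a l IH]; simpl; intros B H.
  - destruct H as [<-|[]]; apply incl_refl.
  - apply in_app_or in H; destruct H as [H|H].
    + apply in_map_iff in H; destruct H as [B' [<- H]].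
      apply incl_cons; [now left|apply incl_tl; auto].
    + apply incl_tl; auto.
Qed.

Lemma sublists_NoDup {A : Type} (l B : list A) :
  NoDup l -> In B (sublists l) -> NoDup B.
Proof.
  revert B; induction l as [|a l IH]; simpl; intros B Hl H.
  - destruct H as [<-|[]]; constructor.
  - inversion Hl; subst; apply in_app_or in H; destruct H as [H|H]; auto.
    apply in_map_iff in H; destruct H as [B' [<- H]]; constructor; auto.
    intros Ha; apply sublists_incl in H; auto.
Qed.

Definition memb (A : list nat) (v : nat) : bool := existsb (Nat.eqb v) A.

Lemma memb_In (A : list nat) (v : nat) : memb A v = true <-> In v A.
Proof.
  unfold memb; rewrite existsb_exists; split.
  - intros [u [Hu E]]; apply Nat.eqb_eq in E; now subst.
  - intros H; exists v; split; [exact H|apply Nat.eqb_refl].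
Qed.

Definition no_edge (P : nat * nat -> bool) (es : list (nat * nat)) (g : graph) : bool :=
  negb (existsb (fun eb => snd eb && P (fst eb)) (combine es g)).

(** By independence, each pair selected by [P] contributes the factor [1 - ph] of being absent, and
    every other pair the factor 1. *)
Lemma Egraph_no_edge (ph : R) (P : nat * nat -> bool) (es : list (nat * nat)) :
  Egraph ph (length es) (fun g => ind (no_edge P es g)) = (1 - ph) ^ length (filter P es).
Proof.
  induction es as [|e es IH]; [unfold Egraph, Rsum, stat_prob; simpl; ring|].
  simpl length; rewrite Egraph_S.
  rewrite (Egraph_ext _ _ _ (fun g => ind (negb (P e)) * ind (no_edge P es g))).
  - rewrite Egraph_scal.
    change (fun g => ind (no_edge P (e :: es) (false :: g)))
      with (fun g => ind (no_edge P es g)).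
    rewrite IH; simpl; destruct (P e); simpl; ring.
  - intros g; unfold no_edge; simpl; destruct (P e); simpl; ring.
Qed.

Lemma in_edges (n i j : nat) : In (i, j) (edges n) <-> (i < j < n)%nat.
Proof.
  unfold edges; rewrite in_flat_map; split.
  - intros [x [Hx H]]; apply in_map_iff in H; destruct H as [y [E Hy]].
    injection E as -> ->; apply in_seq in Hx, Hy; lia.
  - intros H; exists j; split; [apply in_seq; lia|].
    apply in_map_iff; exists i; split; [reflexivity|apply in_seq; lia].
Qed.

Lemma NoDup_list_prod {A B : Type} (l : list A) (l' : list B) :
  NoDup l -> NoDup l' -> NoDup (list_prod l l').
Proof.
  intros Hl Hl'; induction Hl as [|a l Ha Hl IH]; simpl; [constructor|].
  apply NoDup_app; [|exact IH|].
  - apply NoDup_map_NoDup_ForallPairs; [|exact Hl'].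
    intros x y _ _ E; now injection E.
  - intros [x y] H H'; apply in_map_iff in H; destruct H as [z [E _]].
    injection E as -> ->; apply in_prod_iff in H'; tauto.
Qed.

Definition between (A D : list nat) (e : nat * nat) : bool :=
  (memb A (fst e) && memb D (snd e)) || (memb A (snd e) && memb D (fst e)).

(** Sorting the two entries sends [A * D] into the edges between the sets; disjointness makes this
    map injective. *)
Lemma between_count (n : nat) (A D : list nat) :
  NoDup A -> NoDup D -> incl A (seq 0 n) -> incl D (seq 0 n) ->
  (forall v, In v A -> ~ In v D) ->
  (length A * length D <= length (filter (between A D) (edges n)))%nat.
Proof.
  intros HA HD IA ID Hdis.
  set (s := fun uv : nat * nat => (Nat.min (fst uv) (snd uv), Nat.max (fst uv) (snd uv))).
  rewrite <- length_prod, <- (length_map s).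
  apply NoDup_incl_length.
  - apply NoDup_map_NoDup_ForallPairs; [|now apply NoDup_list_prod].
    intros [u v] [u' v'] H H' E; apply in_prod_iff in H, H'.
    unfold s in E; simpl in E; injection E as E1 E2.
    destruct H as [Hu Hv], H' as [Hu' Hv'].
    (* Two pairs with the same sorted form agree or are swapped; a swap would put [u] in both [A]
       and [D]. *)
    destruct (Nat.eq_dec u u') as [<-|Hne]; [f_equal; lia|].
    assert (u = v') by lia; subst; now apply Hdis in Hu.
  - intros e He; apply in_map_iff in He; destruct He as [[u v] [<- H]].
    apply in_prod_iff in H; destruct H as [Hu Hv].
    assert (u <> v) by (intros ->; now apply Hdis in Hu).
    pose proof (IA u Hu) as Lu; pose proof (ID v Hv) as Lv.
    apply in_seq in Lu, Lv.
    apply filter_In; unfold s; simpl; split; [apply in_edges; lia|].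
    apply memb_In in Hu, Hv; unfold between; simpl.
    destruct (Nat.le_gt_cases u v).
    + rewrite Nat.min_l, Nat.max_r, Hu, Hv by lia; reflexivity.
    + rewrite Nat.min_r, Nat.max_l, Hu, Hv by lia; apply orb_true_r.
Qed.

(** As [flood_step] retains [A], this includes disjointness of [A] and [D] as well as the absence of
    edges between them. *)
Definition separated (n : nat) (g : graph) (A D : list nat) : bool :=
  forallb (fun v => negb (flood_step n g (memb A) v)) D.

Lemma separated_disjoint (n : nat) (g : graph) (A D : list nat) :
  separated n g A D = true -> forall v, In v A -> ~ In v D.
Proof.
  unfold separated; rewrite forallb_forall; intros H v HA HD.
  specialize (H v HD); unfold flood_step in H.
  apply memb_In in HA; rewrite HA in H; discriminate.
Qed.

Lemma separated_no_edge (n : nat) (g : graph) (A D : list nat) :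
  incl A (seq 0 n) -> separated n g A D = true ->
  no_edge (between A D) (edges n) g = true.
Proof.
  unfold separated, no_edge; rewrite forallb_forall; intros IA H.
  destruct (existsb _ _) eqn:E; [exfalso|reflexivity].
  apply existsb_exists in E; destruct E as [[e b] [Hin Hb]]; simpl in Hb.
  apply andb_true_iff in Hb; destruct Hb as [-> Hb].
  assert (K : exists u v, In u A /\ In v D /\ adj n g u v = true).
  { unfold between in Hb; apply orb_true_iff in Hb.
    destruct Hb as [Hb|Hb]; apply andb_true_iff in Hb; destruct Hb as [H1 H2];
      apply memb_In in H1, H2.
    - exists (fst e), (snd e); repeat split; auto.
      apply existsb_exists; exists (e, true); split; [exact Hin|].
      rewrite !Nat.eqb_refl; reflexivity.
    - exists (snd e), (fst e); repeat split; auto.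
      apply existsb_exists; exists (e, true); split; [exact Hin|].
      rewrite !Nat.eqb_refl; apply orb_true_r. }
  destruct K as [u [v [Hu [Hv Hadj]]]].
  specialize (H v Hv); apply negb_true_iff in H; unfold flood_step in H.
  apply orb_false_iff in H; destruct H as [_ H].
  assert (existsb (fun w => memb A w && adj n g w v) (seq 0 n) = true); [|congruence].
  apply existsb_exists; exists u; split; [now apply IA|].
  apply memb_In in Hu; now rewrite Hu, Hadj.
Qed.

Lemma pow_le_antitone (x : R) (a b : nat) : 0 <= x <= 1 -> (a <= b)%nat -> x ^ b <= x ^ a.
Proof.
  intros Hx H; induction H as [|b H IH]; [apply Rle_refl|]; simpl.
  assert (0 <= x ^ b) by (apply pow_le; lra); nra.
Qed.

(** Sets that meet are never separated. For disjoint sets, at least [length A * length D]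
    independent pairs must all be absent. *)
Lemma separated_prob (n : nat) (ph : R) (A D : list nat) :
  0 <= ph <= 1 -> In A (sublists (seq 0 n)) -> In D (sublists (seq 0 n)) ->
  Egraph ph (length (edges n)) (fun g => ind (separated n g A D))
  <= (1 - ph) ^ (length A * length D).
Proof.
  intros Hp HA HD.
  pose proof (sublists_incl _ _ HA) as IA; pose proof (sublists_incl _ _ HD) as ID.
  apply (sublists_NoDup _ _ (seq_NoDup n 0)) in HA, HD.
  destruct (existsb (memb D) A) eqn:E.
  - apply existsb_exists in E; destruct E as [v [HvA HvD]]; apply memb_In in HvD.
    apply Rle_trans with (Egraph ph (length (edges n)) (fun _ => 0)).
    + apply Egraph_le; [exact Hp|]; intros g.
      destruct (separated n g A D) eqn:S; simpl; [|lra].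
      now destruct (separated_disjoint _ _ _ _ S v HvA).
    + rewrite Egraph_const; apply pow_le; lra.
  - apply Rle_trans with
      (Egraph ph (length (edges n)) (fun g => ind (no_edge (between A D) (edges n) g))).
    + apply Egraph_le; [exact Hp|]; intros g.
      destruct (separated n g A D) eqn:S; [|apply ind_bounds].
      rewrite separated_no_edge; auto; apply Rle_refl.
    + rewrite Egraph_no_edge; apply pow_le_antitone; [lra|].
      apply between_count; auto.
      intros v HvA HvD.
      assert (existsb (memb D) A = true); [|congruence].
      apply existsb_exists; exists v; split; [exact HvA|now apply memb_In].
Qed.

(** * Flooding a sequence of expanding graphs *)

Definition size (n : nat) (I : nat -> bool) : nat := length (filter I (seq 0 n)).

Lemma filter_le_length {A : Type} (P Q : A -> bool) (l : list A) :
  (forall x, In x l -> P x = true -> Q x = true) ->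
  (length (filter P l) <= length (filter Q l))%nat.
Proof.
  induction l as [|a l IH]; intros H; simpl; [lia|].
  assert (IH' : (length (filter P l) <= length (filter Q l))%nat)
    by (apply IH; intros x Hx; apply H; now right).
  specialize (H a (or_introl eq_refl)).
  destruct (P a); [rewrite H by reflexivity|destruct (Q a)]; simpl; lia.
Qed.

Lemma size_mono (n : nat) (I J : nat -> bool) :
  (forall v, (v < n)%nat -> I v = true -> J v = true) -> (size n I <= size n J)%nat.
Proof.
  intros H; apply filter_le_length; intros v Hv; apply in_seq in Hv; apply H; lia.
Qed.

Lemma size_memb (n : nat) (A : list nat) :
  NoDup A -> incl A (seq 0 n) -> size n (memb A) = length A.
Proof.
  intros HA IA; apply Permutation_length, NoDup_Permutation;
    [apply NoDup_filter, seq_NoDup|exact HA|].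
  intros v; rewrite filter_In, memb_In; split; [tauto|auto].
Qed.

Lemma size_complement (n : nat) (I : nat -> bool) :
  (size n I + length (filter (fun v => negb (I v)) (seq 0 n)) = n)%nat.
Proof.
  unfold size; rewrite filter_length; apply length_seq.
Qed.

Lemma size_pos (n s : nat) (I : nat -> bool) :
  (s < n)%nat -> I s = true -> (1 <= size n I)%nat.
Proof.
  intros Hs HI; unfold size.
  assert (H : In s (filter I (seq 0 n)))
    by (apply filter_In; split; [apply in_seq; lia|exact HI]).
  destruct (filter I (seq 0 n)); [contradiction|simpl; lia].
Qed.

Lemma flood_step_spec (n : nat) (g : graph) (I : nat -> bool) (v : nat) :
  flood_step n g I v = true <->
  I v = true \/ exists u, (u < n)%nat /\ I u = true /\ adj n g u v = true.
Proof.
  unfold flood_step; rewrite orb_true_iff, existsb_exists; split.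
  - intros [H|[u [Hu H]]]; [now left|right; exists u].
    apply in_seq in Hu; apply andb_true_iff in H; split; [lia|tauto].
  - intros [H|[u [Hu H]]]; [now left|right; exists u].
    split; [apply in_seq; lia|now apply andb_true_iff].
Qed.

Lemma flood_step_mono (n : nat) (g : graph) (I J : nat -> bool) :
  (forall v, (v < n)%nat -> I v = true -> J v = true) ->
  forall v, (v < n)%nat -> flood_step n g I v = true -> flood_step n g J v = true.
Proof.
  intros H v Hv; rewrite !flood_step_spec; intros [Hi|[u [Hu [Hi Ha]]]]; auto.
  right; exists u; auto.
Qed.

Lemma adj_sym (n : nat) (g : graph) (u v : nat) : adj n g u v = adj n g v u.
Proof.
  unfold adj; induction (combine (edges n) g) as [|[e b] l IH]; simpl;
    [reflexivity|]; rewrite IH; f_equal; f_equal; apply orb_comm.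
Qed.

Lemma informed_app (n : nat) (tr tr' : list graph) (I : nat -> bool) :
  informed n (tr ++ tr') I = informed n tr' (informed n tr I).
Proof. revert I; induction tr as [|g tr IH]; intros I; simpl; auto. Qed.

(* Reversing the trajectory turns paths from [u] to [v] into paths from [v] to
   [u], so it suffices that the set reached from [v] backwards in time meets
   the informed set. *)
Lemma informed_rev (n : nat) (tr : list graph) (I : nat -> bool) (u v : nat) :
  (u < n)%nat -> (v < n)%nat -> I u = true ->
  informed n (rev tr) (fun w => (v =? w)%nat) u = true -> informed n tr I v = true.
Proof.
  revert I u; induction tr as [|g tr IH]; intros I u Hu Hv HI H; simpl in *.
  - apply Nat.eqb_eq in H; now subst.
  - rewrite informed_app in H; simpl in H; apply flood_step_spec in H.
    destruct H as [H|[w [Hw [H Ha]]]].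
    + apply (IH _ u); auto; apply flood_step_spec; now left.
    + apply (IH _ w); auto; apply flood_step_spec; right.
      exists u; rewrite adj_sym; auto.
Qed.

Definition expands (n K : nat) (r : R) (g : graph) : Prop :=
  forall I, (1 <= size n I <= K)%nat -> r * INR (size n I) <= INR (size n (flood_step n g I)).

(** Fewer than [z] nodes stay unreached, so every set of at least [z] nodes meets the reached
    one. *)
Definition mixes (n z : nat) (g : graph) : Prop :=
  forall I, (z <= size n I)%nat -> (n < size n (flood_step n g I) + z)%nat.

(** Expansion speaks only of sets of at most [K] nodes; a larger set is cut down to [K] of its
    nodes, and [flood_step] is monotone. *)
Lemma expands_large (n K z : nat) (r : R) (g : graph) (I : nat -> bool) :
  expands n K r g -> (1 <= K)%nat -> INR z <= r * INR K -> (K <= size n I)%nat ->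
  (z <= size n (flood_step n g I))%nat.
Proof.
  intros Hg HK Hz HI.
  set (A := firstn K (filter I (seq 0 n))).
  assert (IA : incl A (filter I (seq 0 n))).
  { intros v Hv; rewrite <- (firstn_skipn K (filter I (seq 0 n))).
    apply in_or_app; now left. }
  assert (SA : size n (memb A) = K).
  { rewrite size_memb.
    - unfold A; rewrite length_firstn; unfold size in HI; lia.
    - assert (H : NoDup (filter I (seq 0 n))) by apply NoDup_filter, seq_NoDup.
      rewrite <- (firstn_skipn K (filter I (seq 0 n))) in H.
      now apply NoDup_app_remove_r in H.
    - intros v Hv; apply IA, filter_In in Hv; tauto. }
  assert (H : (size n (flood_step n g (memb A)) <= size n (flood_step n g I))%nat).
  { apply size_mono, flood_step_mono; intros v _ Hv.
    apply memb_In, IA, filter_In in Hv; tauto. }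
  specialize (Hg (memb A)); rewrite SA in Hg; specialize (Hg (conj HK (le_n K))).
  apply INR_le; apply le_INR in H; lra.
Qed.

(** The lower bound [a] gains a factor [r] per step until it is capped at [z]. Below [K] nodes this
    is expansion; from [K] nodes on, [expands_large] gives [z] at once, which also keeps the bound
    at [z] afterwards. *)
Lemma informed_growth (n K z : nat) (r a : R) (tr : list graph) (I : nat -> bool) :
  (forall g, In g tr -> expands n K r g) ->
  1 <= r -> 1 <= a -> (1 <= K)%nat -> (1 <= z)%nat -> INR z <= r * INR K ->
  Rmin a (INR z) <= INR (size n I) ->
  Rmin (a * r ^ length tr) (INR z) <= INR (size n (informed n tr I)).
Proof.
  intros Hg Hr Ha HK Hz HzK; revert a I Ha Hg.
  induction tr as [|g tr IH]; intros a I Ha Hg HI; simpl; [now rewrite Rmult_1_r|].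
  rewrite <- Rmult_assoc; apply IH; [nra|intros g' H; apply Hg; now right|].
  assert (Hex : expands n K r g) by (apply Hg; now left).
  apply le_INR in Hz; simpl in Hz.
  destruct (Nat.le_gt_cases K (size n I)) as [HK'|HK'].
  - pose proof (expands_large n K z r g I Hex HK HzK HK') as H.
    apply le_INR in H; apply Rle_trans with (2 := H); apply Rmin_r.
  - assert (H1 : (1 <= size n I)%nat).
    { apply INR_le; simpl; apply Rle_trans with (2 := HI); now apply Rmin_glb. }
    specialize (Hex I ltac:(lia)); apply Rle_trans with (2 := Hex).
    apply le_INR in H1; simpl in H1; unfold Rmin in *.
    destruct (Rle_dec (a * r) (INR z)), (Rle_dec a (INR z)); nra.
Qed.

(** The trajectory is cut into a prefix, one graph [g] and the last [t] graphs. The set reached from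
    [s] through the prefix and the set reached from [v] backwards through the last [t] graphs both
    have at least [z] nodes, and mixing in [g] joins them. *)
Lemma flooded_by_expanding (n K z t : nat) (r : R) (tr : list graph) :
  (forall g, In g tr -> expands n K r g /\ mixes n z g) ->
  1 <= r -> (1 <= K)%nat -> (1 <= z)%nat -> INR z <= r * INR K ->
  INR z <= r ^ t -> (2 * t + 1 <= length tr)%nat ->
  flooded_by n tr = true.
Proof.
  intros Hg Hr HK Hz HzK Ht Hlen.
  assert (Hgrow : forall s tr', (s < n)%nat -> (forall g, In g tr' -> In g tr) ->
     (t <= length tr')%nat -> (z <= size n (informed n tr' (fun v => (s =? v)%nat)))%nat).
  { intros s tr' Hs Hin Hl; apply INR_le.
    assert (H : Rmin (1 * r ^ length tr') (INR z)
             <= INR (size n (informed n tr' (fun v => (s =? v)%nat)))).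
    { apply informed_growth with K; auto; [intros g H; now apply Hg, Hin|lra|].
      apply Rle_trans with 1; [apply Rmin_l|].
      apply (le_INR 1), (size_pos n s); [exact Hs|apply Nat.eqb_refl]. }
    pose proof (Rle_pow r t (length tr') Hr Hl).
    rewrite Rmin_right in H; lra. }
  unfold flooded_by; apply forallb_forall; intros s Hs; apply in_seq in Hs.
  apply forallb_forall; intros v Hv; apply in_seq in Hv.
  (* This leaves exactly [t] graphs after [g], and at least [t] before it since
     [2 * t + 1 <= length tr]. *)
  set (k := (length tr - t - 1)%nat).
  assert (E : exists g tr2, tr = firstn k tr ++ g :: tr2 /\ length tr2 = t).
  { pose proof (firstn_skipn k tr) as E; pose proof (length_skipn k tr) as L.
    destruct (skipn k tr) as [|g tr2]; simpl in L; [lia|].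
    exists g, tr2; split; [now symmetry|lia]. }
  destruct E as [g [tr2 [E L2]]]; set (tr1 := firstn k tr) in *.
  assert (L1 : (t <= length tr1)%nat) by (unfold tr1; rewrite length_firstn; lia).
  assert (Hin : forall x, In x tr1 \/ x = g \/ In x tr2 -> In x tr).
  { intros x Hx; rewrite E; apply in_or_app; simpl; intuition. }
  rewrite E, informed_app; simpl.
  set (I := informed n tr1 (fun v => (s =? v)%nat)).
  set (B := informed n (rev tr2) (fun w => (v =? w)%nat)).
  assert (HI : (z <= size n I)%nat) by (apply Hgrow; auto; lia).
  assert (HB : (z <= size n B)%nat).
  { apply Hgrow; [lia| |rewrite length_rev; lia].
    intros x Hx; apply in_rev in Hx; auto. }
  destruct (Hg g (Hin g (or_intror (or_introl eq_refl)))) as [_ Hmix].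
  specialize (Hmix I HI).
  destruct (existsb (fun u => flood_step n g I u && B u) (seq 0 n)) eqn:X.
  - apply existsb_exists in X; destruct X as [u [Hu X]]; apply in_seq in Hu.
    apply andb_true_iff in X; destruct X as [X1 X2].
    apply (informed_rev n tr2 _ u); auto; lia.
  (* Otherwise [B] lies among the nodes that [I] does not reach in [g], which are fewer than [z]. *)
  - exfalso; pose proof (size_complement n (flood_step n g I)) as HC.
    assert (size n B <= length (filter (fun u => negb (flood_step n g I u)) (seq 0 n)))%nat;
      [|lia].
    apply filter_le_length; intros u Hu HBu.
    destruct (flood_step n g I u) eqn:F; [exfalso|reflexivity].
    assert (existsb (fun u => flood_step n g I u && B u) (seq 0 n) = true); [|congruence].
    apply existsb_exists; exists u; rewrite F, HBu; auto.
Qed.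

(** * Expansion and mixing of random graphs *)

Lemma one_minus_pow_le (x : R) (k : nat) : x <= 1 -> (1 - x) ^ k <= exp (- (INR k * x)).
Proof.
  intros Hx; induction k as [|k IH].
  - simpl; rewrite Rmult_0_l, Ropp_0, exp_0; lra.
  - rewrite S_INR; simpl.
    replace (- ((INR k + 1) * x)) with (- x + - (INR k * x)) by ring.
    rewrite exp_plus; apply Rmult_le_compat; [lra|apply pow_le; lra| |exact IH].
    pose proof (exp_ineq1_le (- x)); lra.
Qed.

Lemma exp_le (x y : R) : x <= y -> exp x <= exp y.
Proof.
  intros [H| ->]; [now apply Rlt_le, exp_increasing|apply Rle_refl].
Qed.

Lemma ln_le (x y : R) : 0 < x -> x <= y -> ln x <= ln y.
Proof.
  intros Hx [H| ->]; [now apply Rlt_le, ln_increasing|apply Rle_refl].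
Qed.

(** From [exp y >= 1 + y] and [(1 + y) * (1 - y / 2) >= 1] on this range. *)
Lemma exp_neg_le (y : R) : 0 <= y <= 1 -> exp (- y) <= 1 - y / 2.
Proof.
  intros Hy; rewrite exp_Ropp; pose proof (exp_ineq1_le y) as H.
  apply Rmult_le_reg_l with (exp y); [apply exp_pos|].
  rewrite Rinv_r by (apply Rgt_not_eq, exp_pos); nra.
Qed.

Lemma exp_minus_one_le (y : R) : 0 <= y <= 1 / 2 -> exp y - 1 <= 2 * y.
Proof.
  intros Hy; pose proof (exp_ineq1_le (- y)) as H; rewrite exp_Ropp in H.
  pose proof (exp_pos y) as P.
  assert ((1 - y) * exp y <= 1); [|nra].
  apply Rle_trans with (/ exp y * exp y).
  - apply Rmult_le_compat_r; lra.
  - rewrite Rinv_l; lra.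
Qed.

(* The inner sum counts the subsets of the nodes that [A] does not reach; it is
   [2 ^ (n - k)] with [k] the number of nodes reached, hence the weight. *)
Definition expand_defect (n K : nat) (r : R) (g : graph) : R :=
  Rsum (fun A =>
      if (1 <=? length A)%nat && (length A <=? K)%nat
      then exp (ln 2 * (r * INR (length A) - INR n))
           * Rsum (fun D => ind (separated n g A D)) (sublists (seq 0 n))
      else 0) (sublists (seq 0 n)).

Definition mix_defect (n z : nat) (g : graph) : R :=
  Rsum (fun A => Rsum (fun D =>
      ind ((z <=? length A)%nat && (z <=? length D)%nat && separated n g A D))
    (sublists (seq 0 n))) (sublists (seq 0 n)).

Lemma expand_defect_term_nonneg (n K : nat) (r : R) (g : graph) (A : list nat) :
  0 <= if (1 <=? length A)%nat && (length A <=? K)%nat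
       then exp (ln 2 * (r * INR (length A) - INR n))
            * Rsum (fun D => ind (separated n g A D)) (sublists (seq 0 n))
       else 0.
Proof.
  destruct (_ && _); [|lra]; apply Rmult_le_pos; [apply Rlt_le, exp_pos|].
  apply Rsum_nonneg; intros; apply ind_bounds.
Qed.

Lemma defect_nonneg (n K z : nat) (r : R) (g : graph) :
  0 <= expand_defect n K r g /\ 0 <= mix_defect n z g.
Proof.
  split; apply Rsum_nonneg; intros A _; [apply expand_defect_term_nonneg|].
  apply Rsum_nonneg; intros; apply ind_bounds.
Qed.

Lemma flood_step_memb_filter (n : nat) (g : graph) (I : nat -> bool) (v : nat) :
  (v < n)%nat ->
  flood_step n g (memb (filter I (seq 0 n))) v = true -> flood_step n g I v = true.
Proof.
  apply flood_step_mono; intros u _ Hu; apply memb_In, filter_In in Hu; tauto.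
Qed.

(** If [Z] nodes are not reached from [A], the term of [A] in the defect is 2 to the power
    [r * |A| - (n - Z)], where [n - Z] is the number of nodes reached. It is at least 1 when
    expansion fails at [A]. *)
Lemma expands_of_defect (n K : nat) (r : R) (g : graph) :
  expand_defect n K r g < 1 -> expands n K r g.
Proof.
  intros Hd I [H1 HK]; set (A := filter I (seq 0 n)).
  pose proof (Rsum_ge_term _ (sublists (seq 0 n)) A (filter_sublists _ _)
                (fun B _ => expand_defect_term_nonneg n K r g B)) as H.
  change (size n I) with (length A) in *; cbv beta in H.
  apply Nat.leb_le in H1, HK; rewrite H1, HK in H; cbn [andb] in H.
  unfold separated in H; rewrite Rsum_sublists_forallb in H.
  pose proof (size_complement n (flood_step n g (memb A))) as HC.
  set (Z := length (filter (fun v => negb _) _)) in H, HC.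
  assert (HS : (size n (flood_step n g (memb A)) <= size n (flood_step n g I))%nat)
    by (apply size_mono; intros v Hv; now apply flood_step_memb_filter).
  apply le_INR in HS; apply (f_equal INR) in HC; rewrite plus_INR in HC.
  apply Rnot_lt_le; intros Hlt.
  assert (L2 : 0 < ln 2) by (rewrite <- ln_1; apply ln_increasing; lra).
  assert (HE : 1 <= exp (ln 2 * (r * INR (length A) - INR n)) * 2 ^ Z).
  { rewrite <- (Rpower_pow Z 2) by lra; unfold Rpower; rewrite <- exp_plus, <- exp_0.
    apply exp_le.
    apply Rle_trans with (ln 2 * (r * INR (length A) - INR n + INR Z)); [|lra].
    apply Rmult_le_pos; lra. }
  unfold expand_defect, separated in Hd; lra.
Qed.

(** A violating set, paired with the set of nodes it does not reach, is a separated pair that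
    contributes 1 to the defect. *)
Lemma mixes_of_defect (n z : nat) (g : graph) :
  mix_defect n z g < 1 -> mixes n z g.
Proof.
  intros Hd I HI; set (A := filter I (seq 0 n)).
  change (size n I) with (length A) in HI.
  set (Q := fun v => negb (flood_step n g (memb A) v)).
  set (D := filter Q (seq 0 n)).
  assert (HS : (size n (flood_step n g (memb A)) <= size n (flood_step n g I))%nat)
    by (apply size_mono; intros v Hv; now apply flood_step_memb_filter).
  pose proof (size_complement n (flood_step n g (memb A))) as HC.
  change (length (filter _ (seq 0 n))) with (length D) in HC.
  destruct (Nat.le_gt_cases z (length D)) as [HD|HD]; [exfalso|lia].
  apply (Rlt_not_le _ _ Hd); unfold mix_defect.
  assert (HQ : separated n g A D = true)
    by (apply forallb_forall; intros v Hv; apply filter_In in Hv; tauto).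
  apply Nat.leb_le in HI, HD.
  eapply Rle_trans; [|apply (Rsum_ge_term _ _ A (filter_sublists _ _))].
  - eapply Rle_trans; [|apply (Rsum_ge_term _ _ D (filter_sublists _ _))].
    + rewrite HI, HD, HQ; apply Rle_refl.
    + intros; apply ind_bounds.
  - intros; apply Rsum_nonneg; intros; apply ind_bounds.
Qed.

(** With [y = k * ph <= 1], the base [1 + (1 - ph) ^ k] is at most [2 * (1 - y / 4)], so the power
    is at most [2 ^ n * exp (- (n * y / 4))]. The weight cancels [2 ^ n] and costs at most
    [exp (n * y / 8)], as [ln 2 <= 1]; half of the exponent survives. *)
Lemma expand_defect_summand_le (n k : nat) (ph : R) :
  0 < ph < 1 -> INR k * ph <= 1 ->
  exp (ln 2 * (INR n * ph / 8 * INR k - INR n)) * (1 + (1 - ph) ^ k) ^ n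
  <= exp (- (INR n * ph / 8)) ^ k.
Proof.
  intros Hp Hk.
  assert (Ik : 0 <= INR k) by apply pos_INR.
  assert (In : 0 <= INR n) by apply pos_INR.
  set (y := INR k * ph) in *; assert (Hy : 0 <= y) by (unfold y; nra).
  assert (HB : (1 - ph) ^ k <= 1 - y / 2).
  { apply Rle_trans with (1 := one_minus_pow_le ph k ltac:(lra)).
    now apply exp_neg_le. }
  assert (HB' : 0 <= (1 - ph) ^ k) by (apply pow_le; lra).
  assert (HP : (1 + (1 - ph) ^ k) ^ n <= exp (ln 2 * INR n) * exp (- (INR n * (y / 4)))).
  { apply Rle_trans with ((2 * (1 - y / 4)) ^ n).
    - apply pow_incr; lra.
    - rewrite Rpow_mult_distr; apply Rmult_le_compat; try (apply pow_le; lra).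
      + rewrite <- Rpower_pow by lra; unfold Rpower; rewrite Rmult_comm; apply Rle_refl.
      + apply one_minus_pow_le; lra. }
  eapply Rle_trans.
  { apply Rmult_le_compat_l; [apply Rlt_le, exp_pos|exact HP]. }
  rewrite <- !exp_plus, <- Rpower_pow by apply exp_pos.
  unfold Rpower; rewrite ln_exp; apply exp_le.
  assert (L2 : ln 2 <= 1) by (rewrite <- (ln_exp 1); apply ln_le; pose proof (exp_ineq1_le 1); lra).
  assert (0 <= INR n * y) by nra.
  replace (INR n * ph / 8 * INR k) with (INR n * y / 8) by (unfold y; field).
  replace (INR k * - (INR n * ph / 8)) with (- (INR n * y / 8)) by (unfold y; field).
  nra.
Qed.

(** For fixed [A], summing [separated_prob] over [D] gives a binomial sum, which the previous bound
    turns into [x ^ length A]; summing over nonempty [A] is again the binomial theorem. *)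
Lemma expand_defect_expectation (n K : nat) (ph : R) :
  0 < ph < 1 -> INR K * ph <= 1 ->
  Egraph ph (length (edges n)) (expand_defect n K (INR n * ph / 8))
  <= (1 + exp (- (INR n * ph / 8))) ^ n - 1.
Proof.
  intros Hp HK; set (r := INR n * ph / 8); set (x := exp (- r)).
  unfold expand_defect; rewrite Egraph_Rsum.
  set (S := sublists (seq 0 n)).
  (* The indicator removes the empty set and so produces the final [- 1]. *)
  apply Rle_trans with (Rsum (fun A => x ^ length A + -1 * ind (length A =? 0)%nat) S).
  - apply Rsum_le; intros A HA.
    assert (Px : 0 <= x ^ length A) by (apply pow_le, Rlt_le, exp_pos).
    destruct ((1 <=? length A)%nat && (length A <=? K)%nat) eqn:E.
    + apply andb_true_iff in E; destruct E as [E1 E2]; apply Nat.leb_le in E1, E2.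
      destruct (Nat.eqb_spec (length A) 0); [lia|simpl; rewrite Rmult_0_r, Rplus_0_r].
      rewrite Egraph_scal, Egraph_Rsum.
      apply le_INR in E2.
      apply Rle_trans with (2 := expand_defect_summand_le n (length A) ph Hp ltac:(nra)).
      apply Rmult_le_compat_l; [apply Rlt_le, exp_pos|].
      pose proof (Rsum_sublists_pow ((1 - ph) ^ length A) (seq 0 n)) as HP.
      rewrite length_seq in HP; rewrite <- HP; apply Rsum_le; intros D HD.
      rewrite <- pow_mult; apply separated_prob; auto; lra.
    + rewrite Egraph_const; destruct (Nat.eqb_spec (length A) 0) as [E0|E0].
      * rewrite E0; simpl; lra.
      * simpl; lra.
  - unfold S; rewrite Rsum_plus, Rsum_scal, Rsum_sublists_pow, length_seq; fold S.
    assert (1 <= Rsum (fun A => ind (length A =? 0)%nat) S); [|lra].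
    apply (Rsum_ge_term (fun A : list nat => ind (length A =? 0)%nat) S nil).
    + unfold S; rewrite <- (filter_false (seq 0 n)); apply filter_sublists.
    + intros; apply ind_bounds.
Qed.

(** Union bound over the [4 ^ n] pairs of sets, of which only those with at least [z * z] node pairs
    between them count. *)
Lemma mix_defect_expectation (n z : nat) (ph : R) :
  0 < ph < 1 ->
  Egraph ph (length (edges n)) (mix_defect n z) <= 4 ^ n * (1 - ph) ^ (z * z).
Proof.
  intros Hp; unfold mix_defect; rewrite Egraph_Rsum.
  set (S := sublists (seq 0 n)); set (w := (1 - ph) ^ (z * z)).
  assert (HS : forall a, Rsum (fun _ : list nat => a) S = a * 2 ^ n).
  { intros a; pose proof (Rsum_sublists_pow 1 (seq 0 n)) as HP.
    rewrite length_seq in HP; replace 2 with (1 + 1) by ring.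
    rewrite <- HP, <- Rsum_scal; apply Rsum_ext; intros B _; rewrite pow1; ring. }
  apply Rle_trans with (Rsum (fun A : list nat => Rsum (fun D : list nat => w) S) S).
  - apply Rsum_le; intros A HA; rewrite Egraph_Rsum; apply Rsum_le; intros D HD.
    destruct ((z <=? length A)%nat && (z <=? length D)%nat) eqn:E.
    + apply andb_true_iff in E; destruct E as [E1 E2]; apply Nat.leb_le in E1, E2.
      apply Rle_trans with ((1 - ph) ^ (length A * length D)).
      * apply separated_prob; auto; lra.
      * apply pow_le_antitone; [lra|nia].
    + simpl; rewrite Egraph_const; apply pow_le; lra.
  - rewrite !HS; apply Req_le; replace 4 with (2 * 2) by ring.
    rewrite Rpow_mult_distr; ring.
Qed.

(** * Numerical parameters and the flooding time *)

Lemma floor_exists (x : R) : 0 <= x -> exists k : nat, INR k <= x < INR k + 1.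
Proof.
  intros Hx; destruct (archimed x) as [H1 H2].
  assert (Hz : (1 <= up x)%Z) by (apply Z.lt_pred_le, lt_IZR; simpl; lra).
  exists (Z.to_nat (up x - 1)); rewrite INR_IZR_INZ, Z2Nat.id, minus_IZR by lia.
  simpl; lra.
Qed.

Lemma defect_expectation (n K z : nat) (ph : R) :
  0 < ph < 1 -> 1 <= ln (INR n) -> 5120 <= INR n * ph ->
  1024 * ln (INR n) <= INR n * ph -> INR K * ph <= 1 -> INR n / 32 <= INR z ->
  Egraph ph (length (edges n))
    (fun g => expand_defect n K (INR n * ph / 8) g + mix_defect n z g)
  <= 3 / INR n ^ 3.
Proof.
  intros Hp Hln Hd1 Hd2 HK Hz.
  assert (Hn : 2 <= INR n) by nra.
  rewrite Egraph_plus.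
  assert (Hx : exp (- (INR n * ph / 8)) <= / INR n ^ 4).
  { rewrite <- Rpower_pow by lra; unfold Rpower; rewrite <- exp_Ropp.
    apply exp_le; simpl; lra. }
  assert (H1 : Egraph ph (length (edges n)) (expand_defect n K (INR n * ph / 8))
               <= 2 / INR n ^ 3).
  { eapply Rle_trans; [now apply expand_defect_expectation|].
    set (x := exp _) in *; assert (0 < x) by apply exp_pos.
    assert (Hnx : INR n * x <= / INR n ^ 3).
    { apply Rle_trans with (INR n * / INR n ^ 4);
        [apply Rmult_le_compat_l; lra|apply Req_le; field; lra]. }
    assert (Hc : / INR n ^ 3 <= 1 / 2).
    { replace (1 / 2) with (/ 2) by field; apply Rinv_le_contravar; [lra|nra]. }
    (* [one_minus_pow_le] at [- x] gives [(1 + x) ^ n <= exp (n * x)]. *)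
    apply Rle_trans with (exp (INR n * x) - 1).
    - apply Rplus_le_compat_r.
      replace (1 + x) with (1 - - x) by ring.
      replace (INR n * x) with (- (INR n * - x)) by ring.
      apply one_minus_pow_le; lra.
    - apply Rle_trans with (2 * (INR n * x)); [apply exp_minus_one_le; nra|].
      unfold Rdiv; apply Rmult_le_compat_l; lra. }
  assert (H2 : Egraph ph (length (edges n)) (mix_defect n z) <= 1 / INR n ^ 3).
  { eapply Rle_trans; [now apply mix_defect_expectation|].
    assert (E4 : 4 ^ n <= exp (2 * INR n)).
    { rewrite <- Rpower_pow by lra; unfold Rpower; apply exp_le.
      rewrite Rmult_comm; apply Rmult_le_compat_r; [lra|].
      rewrite <- (ln_exp 2); apply ln_le; [lra|].
      replace (exp 2) with (exp 1 * exp 1) by (rewrite <- exp_plus; f_equal; ring).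
      pose proof (exp_ineq1_le 1); nra. }
    (* Here [5120 = 5 * 32 ^ 2]: with [z >= n / 32], the exponent [z ^ 2 * ph] is at least [5 * n],
       which beats [4 ^ n <= exp (2 * n)] and leaves [exp (- (3 * n)) <= / n ^ 3]. *)
    assert (Ez : (1 - ph) ^ (z * z) <= exp (- (5 * INR n))).
    { eapply Rle_trans; [apply one_minus_pow_le; lra|]; apply exp_le.
      rewrite mult_INR; apply Ropp_le_contravar.
      apply Rle_trans with (INR n / 32 * (INR n / 32) * ph); [nra|].
      apply Rmult_le_compat_r; [lra|apply Rmult_le_compat; lra]. }
    apply Rle_trans with (exp (2 * INR n) * exp (- (5 * INR n))).
    - apply Rmult_le_compat; auto; apply pow_le; lra.
    - rewrite <- exp_plus; replace (2 * INR n + - (5 * INR n)) with (- (3 * INR n)) by ring.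
      rewrite exp_Ropp; unfold Rdiv; rewrite Rmult_1_l.
      apply Rinv_le_contravar; [apply pow_lt; lra|].
      replace (3 * INR n) with (INR n + (INR n + INR n)) by ring; rewrite !exp_plus.
      pose proof (exp_ineq1_le (INR n)); simpl; rewrite Rmult_1_r.
      repeat apply Rmult_le_compat; nra. }
  unfold Rdiv in *; lra.
Qed.

(** Put [L = ln n / ln d >= 1]. Since [d >= 64], [d / 8] is at least the square root of [d], so
    slightly more than [2 * L] steps suffice for growth to [n]. The resulting
    [2 * t + 1 <= 4 * L + 3] fits below [9 * L - 1], even after rounding [T] down. *)
Lemma flooding_time_bounds (n d : R) :
  5120 <= d < n ->
  exists t : nat, n <= (d / 8) ^ t /\
    (forall T : nat,
       INR T <= 9 * (ln n / ln d + ln (ln d)) < INR T + 1 ->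
       (2 * t + 1 <= T)%nat /\ INR T <= 18 * n).
Proof.
  intros Hd.
  assert (Hld : 1 <= ln d).
  { rewrite <- (ln_exp 1); apply ln_le; [apply exp_pos|]; pose proof exp_le_3; lra. }
  assert (Hln : ln d < ln n) by (apply ln_increasing; lra).
  set (L := ln n / ln d) in *.
  assert (EL : L * ln d = ln n) by (unfold L; field; lra).
  assert (HL : 1 <= L) by nra.
  assert (Hlr : ln d / 2 <= ln (d / 8)).
  { apply Rmult_le_reg_l with 2; [lra|].
    replace (2 * (ln d / 2)) with (ln d) by field.
    replace (2 * ln (d / 8)) with (ln (d / 8) + ln (d / 8)) by ring.
    rewrite <- ln_mult by lra; apply ln_le; nra. }
  assert (HLL : 0 <= ln (ln d)) by (rewrite <- ln_1; apply ln_le; lra).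
  assert (Hlnn : ln n <= n).
  { pose proof (exp_ineq1_le (ln n)) as H; rewrite exp_ln in H by lra; lra. }
  assert (HLL' : ln (ln d) <= ln d).
  { pose proof (exp_ineq1_le (ln (ln d))) as H; rewrite exp_ln in H by lra; lra. }
  destruct (floor_exists (2 * L) ltac:(lra)) as [t [Ht1 Ht2]].
  exists (S t); split.
  - rewrite <- Rpower_pow by lra; unfold Rpower.
    rewrite <- (exp_ln n) at 1 by lra; apply exp_le; rewrite S_INR, <- EL.
    apply Rle_trans with (2 * L * (ln d / 2)); [lra|].
    apply Rmult_le_compat; lra.
  - intros T [HT1 HT2]; split.
    + replace (2 * S t + 1)%nat with (t + t + 3)%nat by lia.
      apply INR_le; rewrite !plus_INR; simpl; lra.
    (* Both [L] and [ln (ln d)] are at most [ln n <= n]. *)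
    + assert (L <= ln n) by nra; lra.
Qed.

Theorem mainTheorem13 :
  exists c C : R, 0 < c /\ 0 < C /\
  exists N : nat, forall n : nat, (N <= n)%nat ->
  forall p q : R, 0 < p < 1 -> 0 < q < 1 ->
  p / (p + q) >= c * ln (INR n) / INR n ->
  exists T : nat,
    INR T <= C * (ln (INR n) / ln (INR n * (p / (p + q)))
                  + ln (ln (INR n * (p / (p + q))))) < INR T + 1 /\
    prob_flooded_by n p q T >= 1 - 1 / INR n.
Proof.
  exists 1024, 9; split; [lra|]; split; [lra|].
  (* [exp 5] ensures [ln n >= 5], hence [d >= 1024 * 5 = 5120]; [54 = 18 * 3] makes the total
     failure bound [18 * n * (3 / n ^ 3)] at most [1 / n]. *)
  destruct (INR_unbounded (exp 5 + 54)) as [N HN].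
  exists N; intros n Hn p q Hp Hq Hph; set (ph := p / (p + q)) in *.
  assert (HNn : exp 5 + 54 < INR n) by (apply le_INR in Hn; lra).
  pose proof (exp_pos 5) as He5.
  assert (Hln : 5 <= ln (INR n)).
  { rewrite <- (ln_exp 5); apply ln_le; lra. }
  assert (Hp1 : 0 < ph < 1).
  { split; [apply Rdiv_lt_0_compat; lra|].
    apply Rmult_lt_reg_r with (p + q); [lra|].
    unfold ph; field_simplify; lra. }
  set (d := INR n * ph).
  assert (Hd : 1024 * ln (INR n) <= d).
  { unfold d; apply Rge_le in Hph.
    apply Rmult_le_compat_l with (r := INR n) in Hph; [|lra].
    replace (1024 * ln (INR n)) with (INR n * (1024 * ln (INR n) / INR n)); [exact Hph|].
    field; lra. }
  assert (Hdn : d < INR n) by (unfold d; nra).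
  destruct (flooding_time_bounds (INR n) d ltac:(lra)) as [t [Ht HT]].
  assert (HX : 0 <= 9 * (ln (INR n) / ln d + ln (ln d))).
  { assert (1 <= ln d).
    { rewrite <- (ln_exp 1); apply ln_le; [apply exp_pos|]; pose proof exp_le_3; lra. }
    assert (0 <= ln (ln d)) by (rewrite <- ln_1; apply ln_le; lra).
    assert (0 <= ln (INR n) / ln d) by (apply Rlt_le, Rdiv_lt_0_compat; lra).
    lra. }
  destruct (floor_exists _ HX) as [T HTf]; exists T; split; [exact HTf|].
  destruct (HT T HTf) as [HtT HTn].
  assert (Hinv : 1 <= / ph) by (rewrite <- Rinv_1; apply Rinv_le_contravar; lra).
  assert (Epi : / ph * ph = 1) by (field; lra).
  (* [K] is the floor of [/ ph]: [K * ph <= 1] is what the expansion estimate requires, and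
     [K * ph >= 1 / 2] makes one expansion step from [K] nodes reach [n / 16 >= z]. *)
  destruct (floor_exists (/ ph) ltac:(lra)) as [K [HK1 HK2]].
  assert (HK : (1 <= K)%nat) by (apply INR_lt; simpl; lra).
  destruct (floor_exists (INR n / 16) ltac:(lra)) as [z [Hz1 Hz2]].
  assert (Hz : (1 <= z)%nat) by (apply INR_lt; simpl; lra).
  assert (HKR : 1 <= INR K) by (apply (le_INR 1); exact HK).
  assert (HKph : INR K * ph <= 1) by nra.
  assert (HzK : INR z <= d / 8 * INR K).
  { assert (1 / 2 <= INR K * ph) by nra; unfold d; nra. }
  pose proof (defect_expectation n K z ph Hp1 ltac:(lra) ltac:(unfold d in *; lra)
                ltac:(unfold d in *; lra) HKph ltac:(lra)) as HE.
  apply Rle_ge.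
  (* Both defects are nonnegative, so their sum being below 1 forces expansion and mixing
     together. *)
  eapply Rle_trans; [|apply (prob_flooded_by_ge n T p q
    (fun g => expand_defect n K (INR n * ph / 8) g + mix_defect n z g) Hp Hq)].
  - fold ph; set (E := Egraph _ _ _) in *.
    assert (INR T * E <= 1 / INR n); [|lra].
    apply Rle_trans with (18 * INR n * (3 / INR n ^ 3)).
    + apply Rle_trans with (INR T * (3 / INR n ^ 3)).
      * apply Rmult_le_compat_l; [apply pos_INR|exact HE].
      * apply Rmult_le_compat_r; [|exact HTn].
        apply Rlt_le, Rdiv_lt_0_compat; [lra|apply pow_lt; lra].
    + apply Rmult_le_reg_r with (INR n ^ 2); [apply pow_lt; lra|].
      field_simplify; lra.
  - intros g; destruct (defect_nonneg n K z (INR n * ph / 8) g); lra.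
  - intros tr Htr Hg.
    apply (flooded_by_expanding n K z t (d / 8)); auto; [|lra|lra|lia].
    intros g Hin; specialize (Hg g Hin).
    destruct (defect_nonneg n K z (INR n * ph / 8) g); split.
    + apply expands_of_defect; unfold d; lra.
    + apply mixes_of_defect; lra.
Qed.
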